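(* Let $\Delta>0$, $\alpha\in(0,1/2)$, and let $m\ge1$ be an integer. Every $\alpha$-correct one-coordinate procedure (randomized sequential test with stopping time $\nu$) satisfies $$\mathbb E_+[\nu]\ge\frac{\mathrm{kl}(1-\alpha,\alpha)}{2\Delta^2},\qquad \mathbb E_-[\nu]\ge\frac{\mathrm{kl}(1-\alpha,\alpha)}{2\Delta^2}.$$ Hence $$C_m^{\mathrm{post}}(\alpha,\Delta)\ge\frac{m\,\mathrm{kl}(1-\alpha,\alpha)}{2\Delta^2}.$$ For every $m$-coordinate procedure satisfying $\sup_{\sigma\in\{-1,+1\}^m}\mathbb P_\sigma(\widehat\sigma_j\ne\sigma_j)\le\alpha$ for all $j=1,\dots,m$, every $\sigma\in\{-1,+1\}^m$, and every $j\in\{1,\dots,m\}$, $$\mathbb E_\sigma[N_j(\tau)]\ge\frac{\mathrm{kl}(1-\alpha,\alpha)}{2\Delta^2},$$ and consequently $$\mathbb E_\sigma[\tau]\ge\frac{m\,\mathrm{kl}(1-\alpha,\alpha)}{2\Delta^2}.$$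
   Context: For $p,q\in(0,1)$, $\mathrm{kl}(p,q)=p\log\frac pq+(1-p)\log\frac{1-p}{1-q}$ (natural logarithm). One-coordinate problem. The unknown sign is $\sigma\in\{-1,+1\}$ and the observations $Z_n\sim N(\sigma\Delta,1)$, $n\ge1$, are independent; $\mathbb P_\sigma$ and $\mathbb E_\sigma$ (also written $\mathbb P_\pm,\mathbb E_\pm$) denote probability and expectation when the true sign is $\sigma$. A randomized sequential test (one-coordinate procedure) consists of a stopping time $\nu$ and a terminal decision $\widehat\sigma\in\{-1,+1\}$; here $\nu$ is a stopping time for the filtration generated by the successive observations $Z_1,Z_2,\dots$ together with internal randomization that is independent of the observations and whose law does not depend on $\sigma$, and $\widehat\sigma$ is measurable with respect to the history stopped at $\nu$. The test is $\alpha$-correct if $\mathbb P_+(\widehat\sigma=-1)\le\alpha$ and $\mathbb P_-(\widehat\sigma=+1)\le\alpha$. $m$-coordinate problem. The unknown parameter is $\sigma=(\sigma_1,\dots,\sigma_m)\in\{-1,+1\}^m$; $\mathbb P_\sigma$ and $\mathbb E_\sigma$ denote probability and expectation under $\sigma$. At each time $t=1,2,\dots$, before the next observation is drawn, a sampling rule chooses $A_t\in\{1,\dots,m\}$ using the past observations and parameter-independent internal randomization. Conditional on the past and on $A_t$, the next observation satisfies $Y_t\sim N(\sigma_{A_t}\Delta,1)$, and the observations are conditionally independent across times. Let $\tau$ be a stopping time (with respect to the history of internal randomization, choices and observations) that is almost surely finite under every $\sigma$, and let $S$ be any random element measurable with respect to the history stopped at $\tau$. Write $N_j(\tau)=\sum_{t=1}^{\tau}\mathbf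 1\{A_t=j\}$ for the number of samples from coordinate $j$. For each $j\in\{1,\dots,m\}$ there is a measurable decoder $d_j$ giving $\widehat\sigma_j=d_j(S)\in\{-1,+1\}$. An $m$-coordinate procedure consists of the sampling rule, $\tau$, $S$ and the decoders $d_1,\dots,d_m$. Define $$C_m^{\mathrm{post}}(\alpha,\Delta)=\inf 2^{-m}\sum_{\sigma\in\{-1,+1\}^m}\mathbb E_\sigma[\tau],$$ the infimum being over all $m$-coordinate procedures satisfying $\sup_{\sigma\in\{-1,+1\}^m}\mathbb P_\sigma(\widehat\sigma_j\ne\sigma_j)\le\alpha$ for $j=1,\dots,m$. *)

(* Defs.v *)
From HB Require Import structures.
From mathcomp Require Import all_boot all_order all_algebra.
From mathcomp Require Import all_classical all_reals all_analysis.
From mathcomp Require Import measurable_realfun.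
Set Implicit Arguments.
Unset Strict Implicit.
Unset Printing Implicit Defensive.
Import Order.TTheory GRing.Theory Num.Theory.
Import numFieldNormedType.Exports.
Local Open Scope classical_set_scope.
Local Open Scope ring_scope.

Definition kl (R : realType) (p q : R) : R :=
  p * ln (p / q) + (1 - p) * ln ((1 - p) / (1 - q)).

(* Signs are booleans: [true] stands for +1 and [false] for -1. *)
Definition sgn (R : realType) (s : bool) : R := if s then 1 else -1.

(* Random times take values in [option nat]; [None] is the value infinity. *)
Definition time_val (R : realType) (t : option nat) : \bar R :=
  if t is Some k then (k%:R)%:E else +oo%E.

Definition stopped_by (t : option nat) (n : nat) : bool :=
  if t is Some k then (k <= n)%N else false.

Definition generated_by (d : measure_display) (Omega : Type)
    (T : measurableType d) (f : Omega -> T) : set (set Omega) :=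
  preimage_set_system setT f measurable.

Definition is_stopping_time (Omega : Type) (F : nat -> set (set Omega))
    (nu : Omega -> option nat) : Prop :=
  forall n, F n [set w | stopped_by (nu w) n].

Definition stopped_history (Omega : Type) (F : nat -> set (set Omega))
    (nu : Omega -> option nat) : set (set Omega) :=
  [set E | <<s \bigcup_n F n >> E /\
           forall n, F n (E `&` [set w | stopped_by (nu w) n])].

Definition expected_time (R : realType) (d : measure_display)
    (Omega : measurableType d) (P : probability Omega R)
    (nu : Omega -> option nat) : \bar R :=
  (\int[P]_w time_val R (nu w))%E.

(* [k] is a version of the conditional law of [X] given the sigma-algebra [G]
   under [P]; it is only used with every [k w] a probability. *)
Definition cond_law (R : realType) (d dT : measure_display)
    (Omega : measurableType d) (T : measurableType dT)
    (P : probability Omega R) (G : set (set Omega)) (X : Omega -> T)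
    (k : Omega -> set T -> \bar R) : Prop :=
  forall B : set T, measurable B ->
    generated_by (fun w => k w B) `<=` G /\
    forall E, G E -> P (E `&` X @^-1` B) = (\int[P]_(w in E) k w B)%E.

(* Observations are indexed from 0: [tZ n] is the (n+1)-st observation, and
   [one_history U Z n] is the information available after n observations.  The
   whole internal randomization is contained in the single random element [tU]
   and is available from the start, which gives the largest filtration of the
   intended kind; it lives in an arbitrary measurable space. *)
Definition one_history (R : realType) (d dU : measure_display)
    (Omega : measurableType d) (UT : measurableType dU) (U : Omega -> UT)
    (Z : nat -> Omega -> R) (n : nat) : set (set Omega) :=
  <<s generated_by U `|`
      \bigcup_(i in [set i | (i < n)%N]) generated_by (Z i) >>.

Record seq_test (R : realType) (Delta : R) := SeqTest {
  tdOmega : measure_display;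
  tOmega : measurableType tdOmega;
  tP : bool -> probability tOmega R;
  tdU : measure_display;
  tUT : measurableType tdU;
  tU : {mfun tOmega >-> tUT};
  tZ : nat -> {mfun tOmega >-> R};
  tnu : tOmega -> option nat;
  tdec : tOmega -> bool;
  t_obs_law : forall s n (C : set R), measurable C ->
    distribution (tP s) (tZ n) C = normal_prob (sgn R s * Delta) 1 C;
  t_indep : forall s n (B : set tUT) (C : nat -> set R),
    measurable B -> (forall i, measurable (C i)) ->
    tP s (tU @^-1` B `&` \bigcap_(i in [set i | (i < n)%N]) (tZ i @^-1` C i)) =
    (tP s (tU @^-1` B) * \prod_(i < n) tP s (tZ i @^-1` C i))%E;
  t_rand_law : forall B : set tUT, measurable B ->
    distribution (tP true) tU B = distribution (tP false) tU B;
  t_stopping : is_stopping_time (one_history tU tZ) tnu;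
  t_decision : forall s,
    stopped_history (one_history tU tZ) tnu [set w | tdec w = s]
}.

Arguments tnu {R Delta} _ _.
Arguments tdec {R Delta} _ _.

Definition alpha_correct (R : realType) (Delta alpha : R)
    (T : seq_test Delta) : Prop :=
  (tP T true [set w | tdec T w = false] <= alpha%:E)%E /\
  (tP T false [set w | tdec T w = true] <= alpha%:E)%E.

Definition E_nu (R : realType) (Delta : R) (T : seq_test Delta) (s : bool) :
    \bar R :=
  expected_time (tP T s) (tnu T).

(* The information carried by the first [a] internal randomization variables
   and the first [b] observations. *)
Definition info (R : realType) (d dU : measure_display)
    (Omega : measurableType d) (UT : measurableType dU) (U : nat -> Omega -> UT)
    (Y : nat -> Omega -> R) (a b : nat) : set (set Omega) :=
  <<s (\bigcup_(i in [set i | (i < a)%N]) generated_by (U i)) `|`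
      (\bigcup_(i in [set i | (i < b)%N]) generated_by (Y i)) >>.

(* Time is indexed from 0: [pA n] and [pY n] are the (n+1)-st choice and the
   (n+1)-st observation.  They are interleaved with internal randomization in
   the order
     pU 0, pA 0, pY 0, pU 1, pA 1, pY 1, pU 2, ...
   so that [info pU pY n n] is the past just before [pU n] is drawn, and
   [info pU pY n.+1 n] is the history after n observations, from which [pA n]
   is computed.  The choices need not be added as generators, as [p_sampling]
   makes them functions of the randomization and the observations; a sampling
   rule that draws the choice at random from a kernel is the case where [pU n]
   determines [pA n].  Parameter independence of the internal randomization
   says that the conditional law [pK n] of [pU n] given the past is the same
   under every parameter.  In particular a single initial seed [pU 0] is
   allowed. *)
Record procedure (R : realType) (m : nat) (Delta : R) := Procedure {
  pdOmega : measure_display;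
  pOmega : measurableType pdOmega;
  pP : {ffun 'I_m -> bool} -> probability pOmega R;
  pdU : measure_display;
  pUT : measurableType pdU;
  pU : nat -> {mfun pOmega >-> pUT};
  pK : nat -> pOmega -> probability pUT R;
  pA : nat -> pOmega -> 'I_m;
  pY : nat -> {mfun pOmega >-> R};
  ptau : pOmega -> option nat;
  pdS : measure_display;
  pST : measurableType pdS;
  pS : pOmega -> pST;
  pdec : 'I_m -> pST -> bool;
  p_rand_law : forall s n, cond_law (pP s) (info pU pY n n) (pU n)
    (fun w => pK n w);
  p_sampling : forall n j, info pU pY n.+1 n [set w | pA n w = j];
  p_obs_law : forall s n, cond_law (pP s) (info pU pY n.+1 n) (pY n)
    (fun w => normal_prob (sgn R (s (pA n w)) * Delta) 1);
  p_stopping : is_stopping_time (fun n => info pU pY n.+1 n) ptau;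
  p_finite : forall s, {ae pP s, forall w, ptau w <> None};
  p_output :
    generated_by pS `<=` stopped_history (fun n => info pU pY n.+1 n) ptau;
  p_decoder : forall j, measurable_fun setT (pdec j)
}.

Arguments pA {R m Delta} _ _ _.
Arguments ptau {R m Delta} _ _.
Arguments pS {R m Delta} _ _.
Arguments pdec {R m Delta} _ _ _.

Definition correct (R : realType) (m : nat) (Delta alpha : R)
    (T : procedure m Delta) : Prop :=
  forall j : 'I_m,
    (ereal_sup [set pP T s [set w | pdec T j (pS T w) <> s j] | s in setT]
       <= alpha%:E)%E.

Definition E_tau (R : realType) (m : nat) (Delta : R) (T : procedure m Delta)
    (s : {ffun 'I_m -> bool}) : \bar R :=
  expected_time (pP T s) (ptau T).

Definition num_samples (R : realType) (m : nat) (Delta : R)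
    (T : procedure m Delta) (j : 'I_m) (w : pOmega T) : \bar R :=
  (\sum_(0 <= n <oo | ~~ stopped_by (ptau T w) n) (pA T n w == j)%:R%:E)%E.

Arguments num_samples {R m Delta} _ _ _.

Definition E_samples (R : realType) (m : nat) (Delta : R)
    (T : procedure m Delta) (s : {ffun 'I_m -> bool}) (j : 'I_m) : \bar R :=
  (\int[pP T s]_w num_samples T j w)%E.

Definition C_post (R : realType) (m : nat) (alpha Delta : R) : \bar R :=
  ereal_inf [set c : \bar R | exists2 T : procedure m Delta, correct alpha T &
    c = ((2 ^- m)%:E * \sum_(s : {ffun 'I_m -> bool}) E_tau T s)%E].

(* Main.v *)
Require Import Defs.
From HB Require Import structures.
From mathcomp Require Import all_boot all_order all_algebra.
From mathcomp Require Import all_classical all_reals all_analysis.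
From mathcomp Require Import measurable_realfun.
From mathcomp Require Import ring lra.
Import Order.TTheory GRing.Theory Num.Theory.
Import numFieldNormedType.Exports.
Set Implicit Arguments.
Unset Strict Implicit.
Unset Printing Implicit Defensive.
Local Open Scope classical_set_scope.
Local Open Scope ring_scope.

(** The bounds come from comparing the law [P] of an experiment with the law
    [Q] of the same experiment after one sign has been reversed.  Let [theta]
    be the mean, under [P], of the observations that depend on this sign; under
    [Q] their mean is [- theta], and everything else has the same conditional
    law given the past.  A Gaussian density satisfies
    [pdf (- theta) y = exp (- 2 theta y) * pdf theta y], so the likelihood
    ratio of [Q] to [P] after [n] observations is [exp (- 2 theta S n)], where
    [S n] is the sum of the relevant observations among the first [n]
    ([history_likelihood], [one_history_likelihood]; the inductive step is
    [likelihood_step]).  Stopping the sum at [tau] keeps this true for the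
    events known at the time [minn tau n] ([stopped_likelihood]).

    Let [D] be the event that the experiment has stopped by time [n] and that
    the decision is the one that is right under [P] and wrong under [Q].  Put
    [r = (1 - alpha) / alpha], and let [f] be [ln r] on [D] and [- ln r] off
    [D].  The inequality [1 + x <= exp x] at [x = f - 2 theta S], where [S] is
    the sum stopped at [tau], integrates under [P] to
      [1 + (2 P(D) - 1) ln r - 2 theta E(S) <= r Q(D) + (1 - Q(D)) / r].
    The right-hand side is at most 1 because [Q(D) <= alpha] and [1 < r], and
    [E(S)] is [theta] times the expected number of relevant observations made
    by time [n] ([masked_sum_mean], a truncated Wald identity).  Thus
    [finite_horizon_bound]:
      [(2 P(D) - 1) ln r <= 2 theta^2 E(number of relevant observations)].
    A run that has not stopped by time [n] counts as a wrong decision here,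
    which keeps the right-hand side of the integrated inequality at most 1.
    As [n] grows, [P(D)] increases to the
    probability of a right decision, which is at least [1 - alpha], and
    [(1 - 2 alpha) ln r] is [kl (1 - alpha) alpha]: this is
    [expected_samples_bound].

    For a sequential test every observation is relevant.  It stops almost
    surely under [P] unless the expected time is infinite, in which case there
    is nothing to prove.  For a procedure, the
    relevant observations are those of coordinate [j]; the numbers of samples
    of the coordinates add up to [tau], and averaging over the parameters gives
    the bound on [C_post]. *)

(** * Measures with a density *)

Section density.
Local Open Scope ereal_scope.
Context d (T : measurableType d) (R : realType).

Section def.
Variables (mu : {measure set T -> \bar R}) (f : T -> R).

Definition density_measure (f0 : forall x, (0 <= f x)%R)
    (intf : mu.-integrable setT (EFin \o f)) (A : set T) : \bar R :=
  \int[mu]_(x in A) (f x)%:E.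

Hypotheses (f0 : forall x, (0 <= f x)%R)
  (intf : mu.-integrable setT (EFin \o f)).

Local Notation nu := (density_measure f0 intf).

Let nu0 : nu set0 = 0. Proof. exact: integral_set0. Qed.

Let nu_ge0 A : 0 <= nu A.
Proof. by apply: integral_ge0 => x _; rewrite lee_fin. Qed.

Let nu_sigma_additive : semi_sigma_additive nu.
Proof.
apply: semi_sigma_additive_nng_induced => [|x]; last by rewrite lee_fin.
exact: measurable_int intf.
Qed.

HB.instance Definition _ := isMeasure.Build _ _ _ nu
  nu0 nu_ge0 nu_sigma_additive.

Let nu_fin : fin_num_fun nu.
Proof.
move=> A mA; apply: integrable_fin_num => //.
by apply: integrableS intf.
Qed.

HB.instance Definition _ := @Measure_isFinite.Build _ _ _ nu nu_fin.

End def.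

(** [f] agrees almost everywhere with the Radon-Nikodym derivative of [nu],
    because both have the same integrals over all measurable sets. *)
Lemma integral_density (mu : {sigma_finite_measure set T -> \bar R})
    (nu : {finite_measure set T -> \bar R}) (f : T -> R)
    (f0 : forall x, (0 <= f x)%R) (mf : measurable_fun setT f)
    (nuE : forall A, measurable A -> nu A = \int[mu]_(x in A) (f x)%:E)
    (E : set T) (g : T -> \bar R) : measurable E -> measurable_fun E g ->
  (forall x, 0 <= g x) ->
  \int[nu]_(x in E) g x = \int[mu]_(x in E) (g x * (f x)%:E).
Proof.
move=> mE mg g0.
have numu : nu `<< mu.
  apply/null_content_dominatesP => A mA muA0; rewrite nuE//.
  apply: null_set_integral => //.
  by apply/measurable_funTS/measurable_EFinP.
rewrite -(Radon_Nikodym_SigmaFinite.change_of_variables numu)//.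
apply: ae_eq_integral => //.
- apply: emeasurable_funM => //; apply/measurable_funTS/measurable_int.
  exact: (Radon_Nikodym_SigmaFinite.f_integrable numu).
- by apply: emeasurable_funM => //; exact/measurable_funTS/measurable_EFinP.
- apply: ae_eqe_mul2l; apply: integral_ae_eq => //.
  + apply: (integrableS measurableT) => //.
    exact: Radon_Nikodym_SigmaFinite.f_integrable.
  + exact/measurable_funTS/measurable_EFinP.
  + move=> A AE mA.
    by rewrite -(Radon_Nikodym_SigmaFinite.f_integral numu)// nuE.
Qed.

End density.

(** * Exponential tilting of Gaussian laws *)

Section gaussian.
Context (R : realType).
Implicit Types c t : R.

(** The normal law is defined on the real line with the sigma-algebra generated
    by the half-open intervals.  Random variables take values in the line with
    its default measurable structure, which has the same measurable sets but is
    another structure; [gaussian] is the normal law on the latter. *)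
Definition gaussian t : set R -> \bar R := normal_prob t 1.

HB.instance Definition _ t := isMeasure.Build _ R R (gaussian t)
  (measure0 (normal_prob t 1)) (measure_ge0 (normal_prob t 1))
  (@measure_semi_sigma_additive _ _ _ (normal_prob t 1)).

HB.instance Definition _ t := @Measure_isProbability.Build _ R R (gaussian t)
  (@probability_setT _ _ _ (normal_prob t 1)).

(** Completing the square: [c y - (y - t)^2/2 = c t + c^2/2 - (y - t - c)^2/2]. *)
Lemma normal_pdf_tilt c t (y : R) :
  expR (c * y) * normal_pdf t 1 y =
  expR (c * t + c ^+ 2 / 2) * normal_pdf (t + c) 1 y.
Proof.
rewrite !normal_pdfE ?oner_eq0// mulrCA [RHS]mulrCA; congr (_ * _).
rewrite /normal_fun -!expRD; congr expR.
by field.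
Qed.

Lemma integral_expR_gaussian c t (B : set R) : measurable B ->
  (\int[gaussian t]_(y in B) (expR (c * y))%:E =
   (expR (c * t + c ^+ 2 / 2))%:E * gaussian (t + c) B)%E.
Proof.
move=> mB.
pose phi : measurableTypeR R -> R := idfun.
have mphi : measurable_fun setT phi by move=> _ C mC; rewrite setTI.
transitivity (\int[pushforward (normal_prob t 1) phi]_(y in B) (expR (c * y))%:E)%E.
  exact: eq_measure_integral.
rewrite ge0_integral_pushforward//; last first.
  by apply/measurable_EFinP/measurable_funTS; apply: measurableT_comp => //.
rewrite (@integral_density _ _ _ lebesgue_measure _ (normal_pdf t 1))//.
- have mB' : measurable (B : set (measurableTypeR R)) by [].
  have mpdf : measurable_fun (B : set (measurableTypeR R))
      (fun y => (normal_pdf (t + c) 1 y)%:E).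
    by apply/measurable_funTS/measurable_EFinP; exact: measurable_normal_pdf.
  rewrite -[gaussian _ B]/(\int[lebesgue_measure]_(y in B)
    (normal_pdf (t + c) 1 y)%:E)%E.
  rewrite -(ge0_integralZl _ mB' mpdf).
  + by apply: eq_integral => y _; rewrite -!EFinM normal_pdf_tilt.
  + by move=> y _; rewrite lee_fin normal_pdf_ge0.
  + by rewrite lee_fin expR_ge0.
- by move=> x; exact: normal_pdf_ge0.
- exact: measurable_normal_pdf.
- apply/measurable_funTS/measurable_EFinP; apply: measurableT_comp => //.
  exact: measurable_funM.
- by move=> y; rewrite lee_fin expR_ge0.
Qed.

(** For [c = - 2 t] the constant [c t + c^2/2] vanishes: this exponential is the
    likelihood ratio of the two signs for one observation. *)
Lemma gaussian_mirror t (B : set R) : measurable B ->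
  (\int[gaussian t]_(y in B) (expR (- (2 * t) * y))%:E =
   gaussian (- t) B)%E.
Proof.
move=> mB; rewrite integral_expR_gaussian//.
rewrite (_ : - (2 * t) * t + _ = 0); last by field.
by rewrite expR0 mul1e; congr (gaussian _ _); ring.
Qed.

Lemma integrable_expR_gaussian c t :
  (gaussian t).-integrable setT (fun y => (expR (c * y))%:E).
Proof.
apply/integrableP; split.
  by apply/measurable_EFinP; apply: measurableT_comp.
under eq_integral do rewrite gee0_abs ?lee_fin ?expR_ge0//.
by rewrite integral_expR_gaussian// probability_setT mule1 ltry.
Qed.

Lemma integrable_id_gaussian t :
  (gaussian t).-integrable setT (fun y : R => y%:E).
Proof.
apply: (le_integrable measurableT _ _ (integrableD measurableT
  (integrable_expR_gaussian 1 t) (integrable_expR_gaussian (-1) t))) => [|y _]/=.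
  exact/measurable_EFinP.
rewrite lee_fin mul1r mulN1r.
rewrite [leRHS]ger0_norm ?addr_ge0 ?expR_ge0// ler_norml.
have := expR_ge1Dx y; have := expR_ge1Dx (- y).
have := expR_ge0 y; have := expR_ge0 (- y).
by move=> *; apply/andP; split; lra.
Qed.

(** Let [m] be the mean.  Integrating [1 + c (y - t) <= exp (c (y - t))] gives
    [c (m - t) <= exp (c^2/2) - 1] for every [c].  The right-hand side is
    quadratic in [c] near 0, hence [m - t = 0]. *)
Lemma integral_id_gaussian t :
  (\int[gaussian t]_y y%:E = t%:E)%E.
Proof.
have intY := integrable_id_gaussian t.
have /fineK <- := integrable_fin_num measurableT intY.
congr EFin.
set m := fine _.
have mE : (\int[gaussian t]_y y%:E = m%:E)%E.
  by rewrite fineK// integrable_fin_num.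
have mgf c : c * (m - t) <= expR (c ^+ 2 / 2) - 1.
  rewrite lerBrDl -lee_fin.
  have -> : (expR (c ^+ 2 / 2))%:E =
     (\int[gaussian t]_y (expR (- (c * t)) * expR (c * y))%:E)%E.
    under eq_integral do rewrite EFinM.
    rewrite ge0_integralZl//; last first.
      by apply/measurable_EFinP; apply: measurableT_comp.
    rewrite integral_expR_gaussian// probability_setT mule1 -EFinM -expRD.
    by congr (expR _)%:E; ring.
  have -> : (1 + c * (m - t))%:E =
     (\int[gaussian t]_y ((1 - c * t)%:E + c%:E * y%:E))%E.
    rewrite integralD//; first last.
    + exact: integrableZl.
    + exact: finite_measure_integrable_cst.
    rewrite integralZl// mE integral_cst// [X in (_ * X)%E]probability_setT mule1.
    by rewrite -EFinM -EFinD; congr EFin; ring.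
  apply: le_integral => //.
  - apply: integrableD => //; last exact: integrableZl.
    exact: finite_measure_integrable_cst.
  - under eq_fun do rewrite EFinM.
    by apply: integrableZl => //; exact: integrable_expR_gaussian.
  - move=> y _; rewrite -EFinM -EFinD lee_fin -expRD.
    by apply: le_trans (expR_ge1Dx _); lra.
apply/eqP; rewrite -subr_eq0; apply/negPn/negP => dn0.
set e := m - t in mgf dn0.
have e2 : 0 < e ^+ 2 by rewrite exprn_even_gt0.
(* With [k * (1 + e^2) = 1] the test point [c = k * e] gives [c * e = 1 - k] and
   [c^2 = k * (1 - k)], while [exp (c^2/2) - 1] is at most [c^2] because
   [c^2/2] is at most 1/2.  This forces [1 - k <= k * (1 - k)], which is false
   for [0 < k < 1]. *)
pose k := (1 + e ^+ 2)^-1.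
have k0 : 0 < k by rewrite invr_gt0; lra.
have ke : k * (1 + e ^+ 2) = 1 by rewrite mulVf// gt_eqF//; lra.
have := mgf (k * e).
set x := (k * e) ^+ 2 / 2.
have xE : x * 2 = k * (k * e ^+ 2) by rewrite /x; field.
have kk : k * e ^+ 2 = 1 - k by lra.
have x0 : 0 <= x by rewrite /x; have := sqr_ge0 (k * e); lra.
have x1 : x <= 1 / 2 by nra.
have hx : 1 - x <= expR (- x) by exact: expR_ge1Dx.
have hxx : expR x * expR (- x) = 1 by rewrite -expRD subrr expR0.
have ex : expR x <= 1 + 2 * x.
  have := expR_gt0 x; nra.
rewrite -mulrA -expr2 kk.
rewrite kk in xE => h.
have k1 : 0 < 1 - k by rewrite -kk mulr_gt0.
have : 0 < (1 - k) * (1 - k) by rewrite mulr_gt0.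
lra.
Qed.

End gaussian.

(** * Sub-sigma-algebras and conditional laws *)

Section sub_sigma_algebra.
Local Open Scope ereal_scope.
Context d (Omega : measurableType d) (R : realType).
Variable G : set (set Omega).
Hypotheses (sG : sigma_algebra setT G) (Gm : G `<=` measurable).

Lemma generated_byP d' (T : measurableType d') (f : Omega -> T) :
  generated_by f `<=` G <-> forall B, measurable B -> G (f @^-1` B).
Proof.
split=> [h B mB|h _ [B mB <-]]; last by rewrite setTI; exact: h.
by apply: h; exists B => //; rewrite setTI.
Qed.

Lemma measurable_fun_sigma d' (T : measurableType d') (f : Omega -> T)
    (D : set Omega) :
  generated_by f `<=` G -> G D ->
  measurable_fun (D : set (g_sigma_algebraType G)) f.
Proof.
move=> /generated_byP fG GD _ B mB.
apply: measurableI; first by rewrite /measurable/= sigma_algebra_id.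
by rewrite /measurable/= sigma_algebra_id//; exact: fG.
Qed.

Lemma generated_by_measurable_fun d' (T : measurableType d') (f : Omega -> T) :
  generated_by f `<=` G -> measurable_fun setT f.
Proof.
by move=> /generated_byP fG _ B mB; rewrite setTI; exact/Gm/fG.
Qed.

Lemma measurable_fun_generated_by d' (T : measurableType d') (f : Omega -> T) :
  measurable_fun setT f -> generated_by f `<=` measurable.
Proof. by move=> mf _ [B mB <-]; exact: mf. Qed.

(** The identity pushes both measures forward to the space whose measurable sets
    are those of [G], and there they coincide. *)
Lemma integral_agree (m1 m2 : {measure set Omega -> \bar R}) (E : set Omega)
    (f : Omega -> \bar R) :
  (forall D, G D -> m1 D = m2 D) -> G E -> generated_by f `<=` G ->
  (forall w, 0 <= f w) ->
  \int[m1]_(w in E) f w = \int[m2]_(w in E) f w.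
Proof.
move=> m12 GE fG f0; pose phi : Omega -> g_sigma_algebraType G := idfun.
have GmE (D : set (g_sigma_algebraType G)) : measurable D -> G D.
  by rewrite /measurable/= sigma_algebra_id.
have mphi : measurable_fun setT phi.
  by move=> _ D /GmE GD; rewrite setTI; exact: Gm.
have mf := measurable_fun_sigma fG GE.
have mE : measurable (E : set (g_sigma_algebraType G)).
  by rewrite /measurable/= sigma_algebra_id.
transitivity (\int[pushforward m1 phi]_(w in E) f w).
  by rewrite [RHS]ge0_integral_pushforward// => w _; exact: f0.
rewrite (@eq_measure_integral _ _ _ _ (pushforward m2 phi)).
  by rewrite ge0_integral_pushforward// => w _; exact: f0.
by move=> A /GmE GA _; rewrite /pushforward m12.
Qed.

End sub_sigma_algebra.

Section conditional_likelihood.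
Local Open Scope ereal_scope.
Context d (Omega : measurableType d) (R : realType).
Variable G : set (set Omega).
Hypotheses (sG : sigma_algebra setT G) (Gm : G `<=` measurable).
Context d' (T : measurableType d').
Variables (X : Omega -> T) (mX : measurable_fun setT X).

Let mpreX B : measurable B -> measurable (X @^-1` B).
Proof. by move=> mB; rewrite -[X @^-1` B]setTI; exact: mX. Qed.

(** A [G]-measurable weight can be taken into the defining equation of a
    conditional law: the measures with densities [\1_(X @^-1` B)] and [k w B]
    with respect to [P] agree on [G], so they give [M] the same integral. *)
Lemma cond_law_weight (P : probability Omega R) (k : Omega -> probability T R)
    (M : Omega -> R) (E : set Omega) (B : set T) :
  cond_law P G X (fun w => k w) -> (forall w, (0 <= M w)%R) ->
  generated_by M `<=` G -> G E -> measurable B ->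
  \int[P]_(w in E `&` X @^-1` B) (M w)%:E =
  \int[P]_(w in E) ((M w)%:E * k w B).
Proof.
move=> Pk M0 MG GE mB; have [kBG kE] := Pk B mB.
have mE := Gm GE.
have mM := generated_by_measurable_fun Gm MG.
have mk := generated_by_measurable_fun Gm kBG.
have k01 w : 0 <= k w B <= 1 by rewrite measure_ge0 probability_le1.
have kfin w : (fine (k w B))%:E = k w B.
  by rewrite fineK// fin_num_measure.
have f0 w : (0 <= fine (k w B))%R by rewrite fine_ge0.
have mf : measurable_fun setT (fun w => fine (k w B)).
  by apply: measurableT_comp => //.
have intf : P.-integrable setT (EFin \o (fun w => fine (k w B))).
  apply: measurable_bounded_integrable => //.
    by rewrite ltey_eq fin_num_measure.
  exists 1%R; split => // x x1 w _.
  rewrite /= ger0_norm// (le_trans _ (ltW x1))//.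
  by rewrite -lee_fin kfin; case/andP: (k01 w).
have inti : P.-integrable setT (EFin \o (\1_(X @^-1` B) : Omega -> R)).
  by apply: integrable_indic; exact: mpreX.
have i0 w : (0 <= \1_(X @^-1` B) w :> R)%R by rewrite indicE.
pose m1 : {finite_measure set Omega -> \bar R} := density_measure i0 inti.
pose m2 : {finite_measure set Omega -> \bar R} := density_measure f0 intf.
transitivity (\int[m1]_(w in E) (M w)%:E).
  rewrite (@integral_density _ _ _ P _ (\1_(X @^-1` B)))//.
  - rewrite integral_mkcondr; apply: eq_integral => w _.
    by rewrite epatch_indic.
  - by apply: measurable_indic; exact: mpreX.
  - exact/measurable_funTS/measurable_EFinP.
rewrite (@integral_agree _ _ _ G sG Gm m1 m2)//.
- rewrite (@integral_density _ _ _ P _ (fun w => fine (k w B)))//.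
    by apply: eq_integral => w _; rewrite kfin.
  exact/measurable_funTS/measurable_EFinP.
- move=> D GD; rewrite /m1 /m2 /= /density_measure /=.
  transitivity (P (D `&` X @^-1` B)).
    by rewrite integral_indic//; [rewrite setIC|exact: Gm|exact: mpreX].
  by rewrite kE//; apply: eq_integral => w _; rewrite kfin.
- apply/generated_byP => C mC.
  move/generated_byP : MG => /(_ (EFin @^-1` C)); apply.
  by rewrite -[_ @^-1` _]setTI; exact: (EFin_measurable measurableT).
Qed.

(** The hypothesis identifies the image under [X] of the measure of density
    [M * \1_E] with the multiple [q] of [lam]; the conclusion is the change of
    variables for this image measure. *)
Lemma integral_weighted_law (mu : {sigma_finite_measure set Omega -> \bar R})
    (M : Omega -> R) (E : set Omega) (q : R) (lam : probability T R)
    (B : set T) (h : T -> \bar R) :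
  measurable E -> (forall w, (0 <= M w)%R) -> measurable_fun setT M ->
  (0 <= q)%R ->
  (forall C, measurable C ->
    \int[mu]_(w in E `&` X @^-1` C) (M w)%:E = q%:E * lam C) ->
  measurable B -> measurable_fun setT h -> (forall x, 0 <= h x) ->
  \int[mu]_(w in E `&` X @^-1` B) ((M w)%:E * h (X w)) =
  q%:E * \int[lam]_(x in B) h x.
Proof.
move=> mE M0 mM q0 EC mB mh h0.
pose f w := (M w * \1_E w)%R.
have f0 w : (0 <= f w)%R by rewrite mulr_ge0.
have mf : measurable_fun setT f.
  by apply: measurable_funM => //; exact: measurable_indic.
have fE D : measurable D ->
    \int[mu]_(w in D) (f w)%:E = \int[mu]_(w in E `&` D) (M w)%:E.
  move=> mD; rewrite setIC integral_mkcondr; apply: eq_integral => w _.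
  by rewrite epatch_indic.
have intf : mu.-integrable setT (EFin \o f).
  apply/integrableP; split; first exact/measurable_EFinP.
  rewrite (eq_integral (fun w => (f w)%:E)); last first.
    by move=> w _; rewrite /= ger0_norm.
  by rewrite fE// -(preimage_setT X) EC// probability_setT mule1 ltry.
pose m : {finite_measure set Omega -> \bar R} := density_measure f0 intf.
pose q' := NngNum q0.
have push C : measurable C -> pushforward m X C = mscale q' lam C.
  move=> mC; rewrite /pushforward /m /= /density_measure fE; last exact: mpreX.
  by rewrite EC.
transitivity (\int[m]_(w in X @^-1` B) h (X w)).
  rewrite (@integral_density _ _ _ mu _ f)//.
  - rewrite setIC integral_mkcondr; apply: eq_integral => w _.
    by rewrite epatch_indic /= /f EFinM muleCA muleA.
  - exact: mpreX.
  - by apply/measurable_funTS; exact: measurableT_comp.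
transitivity (\int[pushforward m X]_(x in B) h x).
  by rewrite [RHS]ge0_integral_pushforward//; exact/measurable_funTS.
rewrite (eq_measure_integral (mscale q' lam)); last first.
  by move=> A mA _; exact: push.
by rewrite ge0_integral_mscale//; exact/measurable_funTS.
Qed.

End conditional_likelihood.

(** * One step of the likelihood ratio *)

(** [M] is the likelihood ratio of [Q] to [P] on the past [G].  The next variable
    [X] has conditional laws [kP] and [kQ] under [P] and [Q]. *)
Section likelihood_step.
Local Open Scope ereal_scope.
Context d (Omega : measurableType d) (R : realType).
Variable G : set (set Omega).
Hypotheses (sG : sigma_algebra setT G) (Gm : G `<=` measurable).
Context d' (T : measurableType d').
Variables (X : Omega -> T) (mX : measurable_fun setT X).
Variables (P Q : probability Omega R) (kP kQ : Omega -> probability T R).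
Hypotheses (hP : cond_law P G X (fun w => kP w))
           (hQ : cond_law Q G X (fun w => kQ w)).
Variable M : Omega -> R.
Hypotheses (M0 : forall w, (0 <= M w)%R) (MG : generated_by M `<=` G).
Hypothesis PQ : forall E, G E -> \int[P]_(w in E) (M w)%:E = Q E.

Let mpreX B : measurable B -> measurable (X @^-1` B).
Proof. by move=> mB; rewrite -[X @^-1` B]setTI; exact: mX. Qed.

Let GT : G setT.
Proof. by case: sG => G0 GC _; rewrite -(setD0 setT); exact: GC. Qed.

Let mM := generated_by_measurable_fun Gm MG.

Let intM : P.-integrable setT (EFin \o M).
Proof.
apply/integrableP; split; first exact/measurable_EFinP.
rewrite (eq_integral (fun w => (M w)%:E)); last first.
  by move=> w _; rewrite /= ger0_norm.
by rewrite PQ// ltey_eq fin_num_measure.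
Qed.

(** The measure of density [M] with respect to [P] agrees with [Q] on [G], hence
    on the [G]-measurable function [kP _ B]. *)
Lemma likelihood_same_law (E : set Omega) (B : set T) :
  G E -> measurable B -> (forall w, E w -> kP w B = kQ w B) ->
  \int[P]_(w in E `&` X @^-1` B) (M w)%:E = Q (E `&` X @^-1` B).
Proof.
move=> GE mB kPQ; have mE := Gm GE.
have [kG _] := hP mB.
rewrite (cond_law_weight sG Gm mX hP)//.
pose m : {finite_measure set Omega -> \bar R} := density_measure M0 intM.
transitivity (\int[m]_(w in E) kP w B).
  rewrite (@integral_density _ _ _ P _ M)//.
    by apply: eq_integral => w _; rewrite muleC.
  exact: measurable_funTS (generated_by_measurable_fun Gm kG).
rewrite (@integral_agree _ _ _ G sG Gm m Q)//.
rewrite (hQ mB).2//; apply: eq_integral => w /[!inE] Ew.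
exact: kPQ.
Qed.

(** On [E] the law of [X] is constant under [P], so under the measure of density
    [M] it is [lam] up to the factor [Q E]. *)
Lemma likelihood_tilted_law (E : set Omega) (B : set T)
    (lam : probability T R) (rho : T -> R) :
  G E -> measurable B -> (forall x, (0 <= rho x)%R) ->
  measurable_fun setT rho ->
  (forall w C, E w -> measurable C -> kP w C = lam C) ->
  (forall w, E w -> kQ w B = \int[lam]_(x in B) (rho x)%:E) ->
  \int[P]_(w in E `&` X @^-1` B) (M w * rho (X w))%:E = Q (E `&` X @^-1` B).
Proof.
move=> GE mB rho0 mrho kPE kQE; have mE := Gm GE.
have QEE : (fine (Q E))%:E = Q E by rewrite fineK// fin_num_measure.
have q0 : (0 <= fine (Q E))%R by rewrite fine_ge0.
have EC C : measurable C ->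
    \int[P]_(w in E `&` X @^-1` C) (M w)%:E = (fine (Q E))%:E * lam C.
  move=> mC; rewrite (cond_law_weight sG Gm mX hP)// QEE -PQ// muleC.
  rewrite -ge0_integralZl//.
  - apply: eq_integral => w /[!inE] Ew.
    by rewrite (kPE w)// muleC.
  - exact/measurable_funTS/measurable_EFinP.
  - by move=> w _; rewrite lee_fin.
under eq_integral do rewrite EFinM.
rewrite (@integral_weighted_law _ _ _ _ _ _ mX _ _ _ _ _ _
  (fun x => (rho x)%:E) mE M0 mM q0 EC mB)//; last first.
  exact/measurable_EFinP.
rewrite (hQ mB).2// QEE.
rewrite [RHS](eq_integral (cst (\int[lam]_(x in B) (rho x)%:E))); last first.
  by move=> w /[!inE] Ew; rewrite kQE.
by rewrite integral_cst// muleC.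
Qed.

Variables (a : Omega -> bool) (lam : probability T R) (rho : T -> R).
Hypotheses (Ga : G [set w | a w]) (rho0 : forall x, (0 <= rho x)%R)
  (mrho : measurable_fun setT rho).
Hypotheses
  (kPa : forall w C, a w -> measurable C -> kP w C = lam C)
  (kQa : forall w C, a w -> measurable C ->
     kQ w C = \int[lam]_(x in C) (rho x)%:E)
  (kPQ : forall w C, ~~ a w -> measurable C -> kP w C = kQ w C).

(** Both sides are finite measures in [E], so it suffices to compare them on the
    sets [A `&` X @^-1` B] with [A] in [G].  Such a set is cut along [a]: the two
    preceding lemmas treat the part where the laws differ by the density [rho]
    and the part where they agree. *)
Lemma likelihood_step (E : set Omega) :
  <<s G `|` generated_by X >> E ->
  \int[P]_(w in E) (M w * (if a w then rho (X w) else 1))%:E = Q E.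
Proof.
pose f w := (M w * (if a w then rho (X w) else 1))%R.
have f0 w : (0 <= f w)%R by rewrite /f mulr_ge0//; case: (a w).
have [_ GC _] := sG.
have Gna : G [set w | ~~ a w].
  have := GC _ Ga; congr G.
  by apply/seteqP; split=> w /=; [case=> _ /negP|move/negP].
have GI A B : G A -> G B -> G (A `&` B).
  move=> GA GB; rewrite -(sigma_algebra_id sG).
  apply: (@measurableI _ (g_sigma_algebraType G)); exact: sub_sigma_algebra.
have ma : measurable_fun setT a.
  apply: (measurable_fun_bool true); rewrite setTI; exact: Gm.
have mf : measurable_fun setT f.
  apply: measurable_funM => //; apply: measurable_fun_ifT => //.
  exact: measurableT_comp.
have rectangle A B : G A -> measurable B ->
    \int[P]_(w in A `&` X @^-1` B) (f w)%:E = Q (A `&` X @^-1` B).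
  move=> GA mB; have mA := Gm GA.
  have AE : A `&` X @^-1` B = (A `&` [set w | a w]) `&` X @^-1` B `|`
     (A `&` [set w | ~~ a w]) `&` X @^-1` B.
    apply/seteqP; split=> [w [Aw Bw]|w [[[Aw _] Bw]|[[Aw _] Bw]]] //=.
    by case: (boolP (a w)) => ?; [left|right].
  have mm b : G b -> measurable ((A `&` b) `&` X @^-1` B).
    by move=> Gb; apply: measurableI; [exact/Gm/GI|exact: mpreX].
  have dis : [disjoint (A `&` [set w | a w]) `&` X @^-1` B &
     (A `&` [set w | ~~ a w]) `&` X @^-1` B].
    apply/disj_setPS => w [[[_ /= aw] _] [[_ /= naw] _]].
    by rewrite aw in naw.
  rewrite AE (ge0_integral_setU _ (mm _ Ga) (mm _ Gna))//; last 2 first.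
  - exact/measurable_funTS/measurable_EFinP.
  - by move=> w _; rewrite lee_fin.
  rewrite measureU//; [|exact: mm|exact: mm|by apply/disj_set2P].
  congr (_ + _).
  - transitivity
      (\int[P]_(w in (A `&` [set w | a w]) `&` X @^-1` B) (M w * rho (X w))%:E).
      apply: eq_integral => w; rewrite inE => -[[_ /= aw] _].
      by rewrite /f aw.
    apply: (@likelihood_tilted_law _ _ lam rho) => //.
    + exact: GI.
    + by move=> w C [_ aw]; exact: kPa.
    + by move=> w [_ aw]; exact: kQa.
  - transitivity
      (\int[P]_(w in (A `&` [set w | ~~ a w]) `&` X @^-1` B) (M w)%:E).
      apply: eq_integral => w; rewrite inE => -[[_ /= /negbTE naw] _].
      by rewrite /f naw mulr1.
    apply: likelihood_same_law => //; first exact: GI.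
    by move=> w [_ naw]; exact: kPQ.
have intf : P.-integrable setT (EFin \o f).
  apply/integrableP; split; first exact/measurable_EFinP.
  rewrite (eq_integral (fun w => (f w)%:E)); last first.
    by move=> w _; rewrite /= ger0_norm.
  rewrite -(setIT setT) -[X in _ `&` X](preimage_setT X) rectangle//.
  by rewrite ltey_eq fin_num_measure//; apply: measurableI => //; exact: mpreX.
pose m : {finite_measure set Omega -> \bar R} := density_measure f0 intf.
pose C := [set D | exists2 A, G A & exists2 B, measurable B & D = A `&` X @^-1` B].
have CT : C setT.
  by exists setT => //; exists setT => //; rewrite setTI preimage_setT.
move=> /= EGX; rewrite -[LHS]/(m E).
apply: (g_sigma_algebra_measure_unique C _ (fun=> setT)) => //.
- move=> _ [A GA [B mB ->]]; apply: measurableI; [exact: Gm|exact: mpreX].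
- by rewrite bigcup_const.
- move=> _ _ [A GA [B mB ->]] [A' GA' [B' mB' ->]].
  exists (A `&` A'); first exact: GI.
  exists (B `&` B'); first exact: measurableI.
  by rewrite preimage_setI setIACA.
- by move=> _ [A GA [B mB ->]]; exact: rectangle.
- by move=> _; rewrite ltey_eq fin_num_measure.
- apply: sub_sigma_algebra2 EGX => D [GD|[B mB <-]].
    by exists D => //; exists setT => //; rewrite preimage_setT setIT.
  by exists setT => //; exists B.
Qed.

End likelihood_step.

(** * A lower bound for stopped tests *)

Lemma series_time (R : realType) (t : option nat) :
  (\sum_(0 <= n <oo | ~~ stopped_by t n) 1%:E = time_val R t)%E.
Proof.
case: t => [k|] /=; last first.
  apply: cvg_lim => //.
  rewrite (_ : (fun _ => _) = fun n => (n%:R)%:E :> \bar R).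
    by apply/cvgenyP; exact: cvg_id.
  apply/funext => n.
  by rewrite sumEFin big_const_nat subn0 iter_addr_0.
rewrite (nneseries_split_cond 0 k)// !add0n.
rewrite [X in (_ + X)%E]eseries0 ?adde0; last first.
  by move=> i -> .
rewrite big_mkcond (eq_big_nat _ _ (F2 := fun=> 1%:E)); last first.
  by move=> i /andP[_ ik]; rewrite -ltnNge ik.
by rewrite sumEFin big_const_nat subn0 iter_addr_0.
Qed.

Definition masked_sum (R : realType) (Omega : Type) (b : nat -> Omega -> bool)
    (Y : nat -> Omega -> R) (n : nat) (w : Omega) : R :=
  \sum_(i < n) (b i w)%:R * Y i w.

Lemma measurable_masked_sum d (T : measurableType d) (R : realType)
    (b : nat -> T -> bool) (Y : nat -> T -> R) n :
  (forall i, (i < n)%N -> measurable_fun setT (Y i)) ->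
  (forall i, (i < n)%N -> measurable [set w | b i w]) ->
  measurable_fun setT (masked_sum b Y n).
Proof.
move=> mY mb; apply: measurable_sum => i.
apply: measurable_funM; last exact: mY.
have -> : (fun w => (b i w)%:R) = \1_[set w | b i w] :> (T -> R).
  by apply/funext => w; rewrite indicE mem_setE.
exact/measurable_indic/mb.
Qed.

(** [a n] tells whether the observation [Y n] is relevant, that is whether its
    law depends on the sign that distinguishes [P] from [Q]. *)
Section stopped_test.
Context d (Omega : measurableType d) (R : realType).
Variables (P Q : probability Omega R) (F : nat -> set (set Omega)).
Hypotheses (sF : forall n, sigma_algebra setT (F n))
  (Fm : forall n, F n `<=` measurable) (F_mono : forall n, F n `<=` F n.+1).
Variables (Y : nat -> Omega -> R) (a : nat -> Omega -> bool) (theta : R).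
Hypotheses (mY : forall n, measurable_fun setT (Y n))
  (Fa : forall n, F n [set w | a n w]).
Hypothesis likelihood : forall n E, F n E ->
  (\int[P]_(w in E) (expR (- (2 * theta) * masked_sum a Y n w))%:E = Q E)%E.
Hypothesis obs_law : forall n E B, F n E -> E `<=` [set w | a n w] ->
  measurable B -> P (E `&` Y n @^-1` B) = (P E * gaussian theta B)%E.
Variable tau : Omega -> option nat.
Hypothesis stopping : is_stopping_time F tau.

Definition sampled_at i w := a i w && ~~ stopped_by (tau w) i.

Let FI n A B : F n A -> F n B -> F n (A `&` B).
Proof.
move=> FA FB; rewrite -(sigma_algebra_id (sF n)).
by apply: (@measurableI _ (g_sigma_algebraType (F n))); exact: sub_sigma_algebra.
Qed.

Let FC n A : F n A -> F n (~` A).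
Proof. by move=> FA; rewrite -setTD; case: (sF n) => _ + _; exact. Qed.

Lemma stopped_by_le (t : option nat) k n :
  (k <= n)%N -> stopped_by t k -> stopped_by t n.
Proof. by case: t => //= t kn tk; exact: leq_trans kn. Qed.

Let F_sampled_at n : F n [set w | sampled_at n w].
Proof.
have -> : [set w | sampled_at n w] =
    [set w | a n w] `&` ~` [set w | stopped_by (tau w) n].
  apply/seteqP; split=> w /=; first by case/andP=> aw /negP.
  by case=> aw /negP nS; apply/andP.
by apply: FI => //; apply: FC; exact: stopping.
Qed.

Let m_sampled_at n : measurable [set w | sampled_at n w].
Proof. exact: Fm. Qed.

Let mW n : measurable_fun setT
  (fun w => expR (- (2 * theta) * masked_sum sampled_at Y n w)).
Proof.
apply: measurableT_comp => //; apply: measurable_funM => //.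
exact: measurable_masked_sum.
Qed.

(** Up to time [n.+1] the stopped ratio differs from the unstopped one only on
    the event that [tau] is at most [n], and there it has not changed since time
    [n].  The hypotheses on [D] say that it is known at the time [minn tau n]. *)
Lemma stopped_likelihood n D : F n D ->
  (forall k, (k < n)%N -> F k (D `&` [set w | stopped_by (tau w) k])) ->
  (\int[P]_(w in D) (expR (- (2 * theta) * masked_sum sampled_at Y n w))%:E =
   Q D)%E.
Proof.
elim: n D => [|n IH] D FD FDk.
  rewrite -(likelihood FD); apply: eq_integral => w _.
  by rewrite /masked_sum !big_ord0.
set S := [set w | stopped_by (tau w) n].
have FS : F n S by exact: stopping.
have FD1 : F n (D `&` S) by exact: FDk.
have FD2 : F n.+1 (D `&` ~` S) by apply: FI => //; apply/F_mono/FC.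
have DE : D = D `&` S `|` D `&` ~` S by rewrite -setIUr setUv setIT.
have dis : D `&` S `&` (D `&` ~` S) = set0 by rewrite setIACA setICr setI0.
have mD1 := Fm FD1; have mD2 := Fm FD2.
have disj : [disjoint D `&` S & D `&` ~` S] by apply/disj_set2P.
rewrite {1}DE (ge0_integral_setU _ mD1 mD2)//; last first.
  by apply/measurable_funTS/measurable_EFinP; exact: mW.
rewrite {3}DE measureU//.
congr (_ + _)%E.
- transitivity (\int[P]_(w in D `&` S)
      (expR (- (2 * theta) * masked_sum sampled_at Y n w))%:E)%E; last first.
    apply: IH => // k kn; have -> : D `&` S `&` [set w | stopped_by (tau w) k] =
        D `&` [set w | stopped_by (tau w) k].
      apply/seteqP; split=> w /= [].
        by move=> [].
      move=> Dw kw; split => //; split => //.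
      exact: stopped_by_le (ltnW kn) kw.
    by apply: FDk; rewrite ltnS ltnW.
  apply: eq_integral => w; rewrite inE => -[_ Sw].
  by rewrite /masked_sum big_ord_recr /= /sampled_at Sw andbF mul0r addr0.
- rewrite -[RHS](likelihood FD2); apply: eq_integral => w.
  rewrite inE => -[_ /= nSw].
  congr (expR (_ * _))%:E; apply: eq_bigr => i _; rewrite /sampled_at.
  suff -> : ~~ stopped_by (tau w) i by rewrite andbT.
  by apply/negP => Sw; apply: nSw; apply: stopped_by_le Sw; rewrite -ltnS.
Qed.

(** [obs_law] says that [Y n] is Gaussian and independent of [D]; the integral of
    [Y n] is split into its positive and negative parts, because the change of
    variables is for nonnegative functions. *)
Lemma obs_integral n D : F n D -> D `<=` [set w | a n w] ->
  P.-integrable D (EFin \o Y n) /\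
  (\int[P]_(w in D) (Y n w)%:E = theta%:E * P D)%E.
Proof.
move=> FD Da; have mD := Fm FD.
have PDE : (fine (P D))%:E = P D by rewrite fineK// fin_num_measure.
have ge0_law (h : R -> \bar R) : measurable_fun setT h ->
    (forall y, 0 <= h y)%E ->
    (\int[P]_(w in D) h (Y n w) = P D * \int[gaussian theta]_y h y)%E.
  move=> mh h0.
  rewrite -PDE -(@integral_weighted_law _ _ _ _ _ _ (mY n) P (cst 1) D
    (fine (P D)) (gaussian theta) setT h)//.
  - by rewrite preimage_setT setIT; apply: eq_integral => w _; rewrite mul1e.
  - by rewrite fine_ge0.
  - move=> C mC; rewrite (eq_integral (cst 1%E))// integral_cst ?mul1e; last first.
      apply: measurableI => //.
      by rewrite -[_ @^-1` _]setTI; exact: mY.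
    by rewrite PDE; exact: obs_law.
have intN := integrable_id_gaussian theta.
have intY : P.-integrable D (EFin \o Y n).
  apply/integrableP; split; first exact/measurable_funTS/measurable_EFinP.
  rewrite /= (ge0_law (fun y => `|y%:E|%E))//; last first.
    by apply: measurableT_comp => //; exact: EFin_measurable.
  have /integrableP[_ +] := intN.
  by rewrite /= => h; rewrite lte_mul_pinfty// fin_num_measure.
split => //.
rewrite integralE.
rewrite (_ : (fun w => (Y n w)%:E) = EFin \o Y n)// funepos_comp funeneg_comp /=.
have mid : measurable_fun setT (@EFin R) by exact: EFin_measurable.
rewrite (ge0_law _ (measurable_funepos mid))//.
rewrite (ge0_law _ (measurable_funeneg mid))//.
rewrite -muleBr//; last 2 first.
- exact: fin_num_measure.
- by apply: fin_num_adde_defr; exact: (integrable_pos_fin_num measurableT intN).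
by rewrite -integralE integral_id_gaussian muleC.
Qed.

(** Wald's identity at the bounded time [minn tau n]: whether the observation
    [i] is taken is decided before it is drawn. *)
Lemma masked_sum_mean n :
  P.-integrable setT (EFin \o masked_sum sampled_at Y n) /\
  (\int[P]_w (masked_sum sampled_at Y n w)%:E =
   theta%:E * \sum_(i < n) P [set w | sampled_at i w])%E.
Proof.
have act i : (forall w, ((sampled_at i w)%:R * Y i w)%:E =
    ((EFin \o Y i) \_ [set w | sampled_at i w]) w)%E.
  move=> w; rewrite patchE.
  have -> : (w \in [set w | sampled_at i w]) = sampled_at i w by rewrite mem_setE.
  by case: (sampled_at i w); rewrite ?mul1r ?mul0r.
have sub i : [set w | sampled_at i w] `<=` [set w | a i w].
  by move=> w /andP[].
have inti i : P.-integrable setT (fun w => ((sampled_at i w)%:R * Y i w)%:E).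
  rewrite (funext (act i)); apply/(integrable_mkcond _ (m_sampled_at i)).
  exact: (obs_integral (F_sampled_at i) (sub i)).1.
have masked_sumE w : (masked_sum sampled_at Y n w)%:E =
    (\sum_(i < n) ((sampled_at i w)%:R * Y i w)%:E)%E.
  by rewrite /masked_sum sumEFin.
split.
  rewrite (_ : _ \o _ =
    fun w => \sum_(i < n) ((sampled_at i w)%:R * Y i w)%:E)%E; last first.
    by apply/funext => w; rewrite /= masked_sumE.
  exact: integrable_sum.
under eq_integral do rewrite masked_sumE.
rewrite integral_sum//.
rewrite ge0_sume_distrr//; apply: eq_bigr => i _.
under eq_integral do rewrite act.
rewrite -integral_mkcond.
exact: (obs_integral (F_sampled_at i) (sub i)).2.
Qed.

Variables (A : set Omega) (alpha : R).
Hypotheses (halpha : 0 < alpha < 1 / 2) (mA : measurable A)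
  (A_stopped : forall n, F n (A `&` [set w | stopped_by (tau w) n]))
  (QA : (Q A <= alpha%:E)%E).

Let r := (1 - alpha) / alpha.

Let r_gt1 : 1 < r.
Proof. by case/andP: halpha => a0 a1; rewrite /r ltr_pdivlMr//; lra. Qed.

(** This integrates [g w <= h w], which is [1 + x <= exp x] at
    [x = ln r - 2 theta S] on [D] and at [x = - ln r - 2 theta S] off [D]. *)
Lemma finite_horizon_bound n :
  (2 * fine (P (A `&` [set w | stopped_by (tau w) n])) - 1) * ln r <=
  2 * theta ^+ 2 * \sum_(i < n) fine (P [set w | sampled_at i w]).
Proof.
set D := A `&` _.
have r0 : 0 < r by rewrite (lt_trans _ r_gt1).
have FD : F n D by exact: A_stopped.
have mD := Fm FD.
have mDC : measurable (~` D) by exact: measurableC.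
have DS k : (k <= n)%N -> D `&` [set w | stopped_by (tau w) k] =
    A `&` [set w | stopped_by (tau w) k].
  move=> kn; apply/seteqP; split=> w /= [].
    by move=> [].
  by move=> Aw kw; split => //; split => //; exact: stopped_by_le kw.
have QD := stopped_likelihood FD.
have {}QD : (\int[P]_(w in D)
    (expR (- (2 * theta) * masked_sum sampled_at Y n w))%:E = Q D)%E.
  by apply: QD => k kn; rewrite DS// ltnW.
have QDC : (\int[P]_(w in ~` D)
    (expR (- (2 * theta) * masked_sum sampled_at Y n w))%:E = Q (~` D))%E.
  apply: stopped_likelihood => [|k kn]; first exact: FC.
  have -> : ~` D `&` [set w | stopped_by (tau w) k] =
      ~` (A `&` [set w | stopped_by (tau w) k]) `&`
      [set w | stopped_by (tau w) k].
    rewrite -(DS k (ltnW kn)) setCI setIUl setICl setU0 //.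
  by apply: FI; [exact/FC/A_stopped|exact: stopping].
have [intT meanT] := masked_sum_mean n.
set t := \sum_(i < n) _.
have tE : (\sum_(i < n) P [set w | sampled_at i w])%E = t%:E.
  by rewrite -sumEFin; apply: eq_bigr => i _; rewrite fineK// fin_num_measure.
rewrite {}tE in meanT.
set p := fine (P D); pose q := fine (Q D).
have pE : P D = p%:E by rewrite /p fineK// fin_num_measure.
have qE : Q D = q%:E by rewrite /q fineK// fin_num_measure.
have qCE : Q (~` D) = (1 - q)%:E by rewrite probability_setC// qE.
have q_le : q <= alpha.
  rewrite -lee_fin -qE; apply: le_trans QA.
  by apply: le_measure; rewrite ?inE//; exact: subIsetl.
pose W w := expR (- (2 * theta) * masked_sum sampled_at Y n w).
pose g w := (1 - ln r) + 2 * ln r * \1_D w -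
  2 * theta * masked_sum sampled_at Y n w.
pose h w := (r * \1_D w + r^-1 * \1_(~` D) w) * W w.
have mh : measurable_fun setT h.
  apply: measurable_funM; last exact: mW.
  by apply: measurable_funD; apply: measurable_funM => //;
    exact: measurable_indic.
have h0 w : 0 <= h w.
  have rV0 : 0 < r^-1 by rewrite invr_gt0.
  by rewrite mulr_ge0 ?expR_ge0// addr_ge0// mulr_ge0// ltW.
have hE : (\int[P]_w (h w)%:E = (r * q + r^-1 * (1 - q))%:E)%E.
  have dis : [disjoint D & ~` D] by apply/disj_set2P; rewrite setICr.
  have mhE : measurable_fun (D `|` ~` D) (fun w => (h w)%:E).
    by rewrite setUv; exact/measurable_EFinP.
  rewrite -(setUv D) (ge0_integral_setU _ mD mDC mhE)//; last first.
    by move=> w _; rewrite lee_fin.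
  have mWE E : measurable_fun E (fun w => (W w)%:E).
    by apply/measurable_funTS/measurable_EFinP; exact: mW.
  have W0 (E : set Omega) w : E w -> (0 <= (W w)%:E)%E.
    by move=> _; rewrite lee_fin expR_ge0.
  have r0E : (0 <= r%:E)%E by rewrite lee_fin ltW.
  have rV0E : (0 <= r^-1%:E)%E by rewrite lee_fin invr_ge0 ltW.
  rewrite EFinD !EFinM -qE -qCE -QD -QDC.
  rewrite -(ge0_integralZl _ mD (mWE D) (W0 D) r0E).
  rewrite -(ge0_integralZl _ mDC (mWE (~` D)) (W0 (~` D)) rV0E).
  congr (_ + _)%E; apply: eq_integral => w wD; rewrite /h /W !indicE.
    by rewrite in_setC wD /= mulr1 mulr0 addr0 EFinM.
  move: wD; rewrite in_setC => /negbTE ->.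
  by rewrite /= mulr1 mulr0 add0r EFinM.
have rE : expR (ln r) = r by rewrite lnK ?posrE.
have gh w : g w <= h w.
  rewrite /g /h /W !indicE in_setC.
  have [wD|wD] := boolP (w \in D); rewrite /= ?mulr1 ?mulr0 ?addr0 ?add0r.
    rewrite -{3}rE -expRD.
    by apply: le_trans (expR_ge1Dx _); lra.
  rewrite -{2}rE -expRN -expRD.
  by apply: le_trans (expR_ge1Dx _); lra.
have i1 : P.-integrable setT (fun=> (1 - ln r)%:E).
  exact: finite_measure_integrable_cst.
have i2 : P.-integrable setT (fun w => (2 * ln r)%:E * (\1_D w)%:E)%E.
  by apply: integrableZl => //; exact: integrable_indic.
have i3 : P.-integrable setT
    (fun w => (2 * theta)%:E * (masked_sum sampled_at Y n w)%:E)%E.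
  exact: integrableZl.
have gEFin : (EFin \o g = fun w => (1 - ln r)%:E + (2 * ln r)%:E * (\1_D w)%:E -
    (2 * theta)%:E * (masked_sum sampled_at Y n w)%:E)%E.
  by apply/funext => w; rewrite /= /g EFinB EFinD !EFinM.
have i12 := integrableD measurableT i1 i2.
have intg : P.-integrable setT (EFin \o g).
  by rewrite gEFin; exact: integrableB.
have gE : (\int[P]_w (g w)%:E =
    (1 - ln r + 2 * ln r * p - 2 * theta * (theta * t))%:E)%E.
  transitivity (\int[P]_w (EFin \o g) w)%E; first by [].
  rewrite gEFin integralB// integralD// !integralZl//; last first.
    exact: integrable_indic.
  rewrite meanT integral_indic// setIT integral_cst//.
  by rewrite [X in (_ * X)%E]probability_setT mule1 [X in (_ + _ * X - _)%E]pE.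
have : 1 - ln r + 2 * ln r * p - 2 * theta * (theta * t) <=
    r * q + r^-1 * (1 - q).
  rewrite -lee_fin -gE -hE; apply: le_integral => //.
  - apply/integrableP; split; first exact/measurable_EFinP.
    rewrite (eq_integral (fun w => (h w)%:E)) ?hE ?ltry//.
    by move=> w _; rewrite /= ger0_norm.
  - by move=> w _; rewrite lee_fin.
(* The left-hand side increases with [q], and equals 1 at [q = alpha]. *)
have : r * q + r^-1 * (1 - q) <= 1.
  case/andP: halpha => a0 a1.
  have rV : r^-1 = alpha / (1 - alpha) by rewrite /r invf_div.
  have rV1 : r^-1 < 1 by rewrite invf_lt1.
  have : 0 <= (alpha - q) * (r - r^-1).
    by rewrite mulr_ge0// subr_ge0// ltW// (lt_trans rV1).
  have : r * alpha = 1 - alpha by rewrite /r divfK// gt_eqF.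
  have : r^-1 * (1 - alpha) = alpha by rewrite rV divfK// gt_eqF//; lra.
  lra.
lra.
Qed.

Hypotheses (PA : (P (~` A) <= alpha%:E)%E) (theta0 : theta != 0)
  (tau_fin : {ae P, forall w, tau w <> None}).

(** The finite-horizon bounds pass to the limit: as [tau] is finite almost
    surely under [P], the probability of having stopped with a right decision by
    time [n] tends to the probability of a right decision. *)
Lemma expected_samples_bound :
  ((kl (1 - alpha) alpha / (2 * theta ^+ 2))%:E <=
   \int[P]_w (\sum_(0 <= n <oo | ~~ stopped_by (tau w) n) (a n w)%:R%:E))%E.
Proof.
have -> : (\int[P]_w (\sum_(0 <= n <oo | ~~ stopped_by (tau w) n) (a n w)%:R%:E)
    = \sum_(0 <= n <oo) P [set w | sampled_at n w])%E.
  transitivity (\int[P]_w (\sum_(0 <= n <oo) (\1_[set w | sampled_at n w] w)%:E))%E.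
    apply: eq_integral => w _; rewrite eseries_mkcond; apply: eq_eseriesr => n _.
    rewrite indicE mem_setE /sampled_at; case: ifPn => //; rewrite /in_mem /= => h.
      by rewrite h andbT.
    by rewrite (negbTE h) andbF.
  rewrite integral_nneseries//.
  - by apply: eq_eseriesr => n _; rewrite integral_indic// setIT.
  - by move=> n; apply/measurable_EFinP; exact: measurable_indic.
set EN := (\sum_(0 <= n <oo) _)%E.
have partial_le n : ((\sum_(i < n) fine (P [set w | sampled_at i w]))%:E <= EN)%E.
  rewrite -sumEFin.
  rewrite (eq_bigr (fun i : 'I_n => P [set w | sampled_at i w])); last first.
    by move=> i _; rewrite fineK// fin_num_measure.
  rewrite -(big_mkord xpredT (fun i => P [set w | sampled_at i w])).
  exact: nneseries_lim_ge.
have EN0 : (0 <= EN)%E by exact: nneseries_ge0.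
have [ENy|ENfin] := eqVneq EN +oo%E; first by rewrite ENy leey.
have ENE : (fine EN)%:E = EN.
  by rewrite fineK// ge0_fin_numE// ltey.
rewrite -ENE lee_fin; move: partial_le; rewrite -ENE.
set T := fine EN => partial_le.
have klE : kl (1 - alpha) alpha = (1 - 2 * alpha) * ln r.
  case/andP: halpha => a0 a1.
  have -> : kl (1 - alpha) alpha = (1 - alpha) * ln r + alpha * ln r^-1.
    by rewrite /kl /r invf_div subKr.
  rewrite lnV; last by rewrite posrE (lt_trans _ r_gt1).
  by ring.
have ln_gt0r : 0 < ln r by rewrite ln_gt0.
have th2 : 0 < theta ^+ 2 by rewrite exprn_even_gt0.
pose c := (1 + 2 * theta ^+ 2 * T / ln r) / 2.
pose B n := A `&` [set w | stopped_by (tau w) n].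
have mB n : measurable (B n) by exact: Fm (A_stopped n).
have p_le n : (P (B n) <= c%:E)%E.
  rewrite -[P _]fineK ?fin_num_measure// lee_fin /c.
  have := finite_horizon_bound n; rewrite -/(B n).
  set p := fine _; set t := \sum_(i < n) _ => h.
  have tT : t <= T by rewrite -lee_fin; exact: partial_le.
  have : 2 * p - 1 <= 2 * theta ^+ 2 * T / ln r.
    rewrite ler_pdivlMr// (le_trans h)// ler_pM2l// mulr_gt0//.
  lra.
have mU : measurable (\bigcup_n B n) by exact: bigcupT_measurable.
have PU : (P (\bigcup_n B n) <= c%:E)%E.
  have ndB : nondecreasing_seq B.
    move=> m n mn; apply/subsetPset => w [Aw /= sw]; split => //=.
    exact: stopped_by_le sw.
  have cvgB := @nondecreasing_cvg_mu _ _ _ P _ mB mU ndB.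
  rewrite -(cvg_lim _ cvgB)//; apply: lime_le; first exact: cvgP cvgB.
  by apply: nearW => n; exact: p_le.
have mN : measurable (A `\` \bigcup_n B n) by exact: measurableD.
have PN : P (A `\` \bigcup_n B n) = 0%E.
  apply: measure_negligible => //; apply: negligibleS tau_fin.
  move=> w [Aw nU] /= tN; apply: nU.
  case tw : (tau w) tN => [k|] // _.
  by exists k => //; split => //=; rewrite tw /=.
have PAc : (P A <= c%:E)%E.
  have -> : A = \bigcup_n B n `|` (A `\` \bigcup_n B n).
    rewrite setDE setUIr setUv setIT; apply/esym/setUidPr.
    by move=> w [n _ []].
  by rewrite measureU0.
have PA1 : 1 - alpha <= c.
  have := PA; rewrite probability_setC// -[P A]fineK ?fin_num_measure//.
  rewrite -EFinB lee_fin; move: PAc.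
  rewrite -[P A]fineK ?fin_num_measure// lee_fin; lra.
rewrite klE ler_pdivrMr; last by rewrite mulr_gt0.
have : (1 - 2 * alpha) <= 2 * theta ^+ 2 * T / ln r by move: PA1; rewrite /c; lra.
by rewrite ler_pdivlMr// [T * _]mulrC.
Qed.

End stopped_test.

(** * Likelihood ratios of Gaussian observations *)

Lemma generated_expR_masked_sum d (Omega : measurableType d) (R : realType)
    (G : set (set Omega)) (c : R) (a : nat -> Omega -> bool)
    (Y : nat -> Omega -> R) n :
  sigma_algebra setT G ->
  (forall i, (i < n)%N -> generated_by (Y i) `<=` G) ->
  (forall i, (i < n)%N -> G [set w | a i w]) ->
  generated_by (fun w => expR (c * masked_sum a Y n w)) `<=` G.
Proof.
move=> sG YG aG.
have GT : G setT by case: sG => G0 GC _; rewrite -(setD0 setT); exact: GC.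
have mf : measurable_fun (setT : set (g_sigma_algebraType G))
    (fun w => expR (c * masked_sum a Y n w)).
  apply: measurableT_comp => //; apply: measurable_funM => //.
  apply: (@measurable_masked_sum _ (g_sigma_algebraType G)) => i /[dup] ni.
    by move=> /YG YiG; exact: measurable_fun_sigma.
  by move=> /aG aiG; rewrite /measurable /= sigma_algebra_id.
apply/generated_byP => B mB.
by have := mf measurableT B mB; rewrite setTI /measurable /= sigma_algebra_id.
Qed.

Lemma gaussian_likelihood_step d (Omega : measurableType d) (R : realType)
    (P Q : probability Omega R) (G : set (set Omega)) (theta : R)
    (a : nat -> Omega -> bool) (Y : nat -> Omega -> R) (n : nat)
    (kP kQ : Omega -> probability R R) :
  sigma_algebra setT G -> G `<=` measurable -> measurable_fun setT (Y n) ->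
  cond_law P G (Y n) (fun w => kP w) -> cond_law Q G (Y n) (fun w => kQ w) ->
  (forall i, (i < n)%N -> generated_by (Y i) `<=` G) ->
  (forall i, (i <= n)%N -> G [set w | a i w]) ->
  (forall w B, a n w -> measurable B -> kP w B = gaussian theta B) ->
  (forall w B, a n w -> measurable B -> kQ w B = gaussian (- theta) B) ->
  (forall w B, ~~ a n w -> measurable B -> kP w B = kQ w B) ->
  (forall E, G E ->
    \int[P]_(w in E) (expR (- (2 * theta) * masked_sum a Y n w))%:E = Q E)%E ->
  forall E, <<s G `|` generated_by (Y n) >> E ->
    (\int[P]_(w in E) (expR (- (2 * theta) * masked_sum a Y n.+1 w))%:E = Q E)%E.
Proof.
move=> sG Gm mY hP hQ YG aG kPa kQa kPQ IH E EG.
have MG : generated_by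
    (fun w => expR (- (2 * theta) * masked_sum a Y n w)) `<=` G.
  by apply: generated_expR_masked_sum => // i ni; exact/aG/ltnW.
have kQE w B : a n w -> measurable B ->
    (kQ w B = \int[gaussian theta]_(y in B) (expR (- (2 * theta) * y))%:E)%E.
  by move=> aw mB; rewrite kQa// -gaussian_mirror.
have mrho : measurable_fun setT (fun y : R => expR (- (2 * theta) * y)).
  by apply: measurableT_comp => //; exact: measurable_funM.
have <- := likelihood_step sG Gm mY hP hQ (fun w => expR_ge0 _) MG IH
  (aG n (leqnn n)) (fun y => expR_ge0 _) mrho kPa kQE kPQ EG.
apply: eq_integral => w _; rewrite /masked_sum big_ord_recr /= mulrDr expRD.
by case: (a n w); rewrite ?mul1r // mul0r mulr0 expR0.
Qed.

(** * Procedures with several coordinates *)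

Section procedure_bound.
Context (R : realType) (m : nat) (Delta alpha : R).
Hypotheses (hDelta : 0 < Delta) (halpha : 0 < alpha < 1 / 2).
Variables (T : procedure m Delta) (s : {ffun 'I_m -> bool}) (j : 'I_m).
Hypothesis Tcorrect : correct alpha T.

Definition flip_sign : {ffun 'I_m -> bool} :=
  [ffun i => if i == j then ~~ s i else s i].

Let theta : R := sgn R (s j) * Delta.
Let P := pP T s.
Let Q := pP T flip_sign.
Let U := @pU _ _ _ T.
Let Y := @pY _ _ _ T.
Let a n w := pA T n w == j.
Let past n := info U Y n n.
Let hist n := info U Y n.+1 n.

Lemma info_sigma_algebra b c : sigma_algebra setT (info U Y b c).
Proof. exact: smallest_sigma_algebra. Qed.

Lemma info_measurable b c : info U Y b c `<=` measurable.
Proof.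
apply: smallest_sub; first exact: sigma_algebra_measurable.
by move=> A [] [i _] /measurable_fun_generated_by; apply; exact: measurable_funPT.
Qed.

Lemma info_mono b c b' c' : (b <= b')%N -> (c <= c')%N ->
  info U Y b c `<=` info U Y b' c'.
Proof.
move=> bb cc; apply: sub_sigma_algebra2 => A [] [i /= ib Ai].
  by left; exists i => //=; exact: leq_trans bb.
by right; exists i => //=; exact: leq_trans cc.
Qed.

Lemma info_obs b c i : (i < c)%N -> generated_by (Y i) `<=` info U Y b c.
Proof. by move=> ic A Ai; apply: sub_sigma_algebra; right; exists i. Qed.

(** A round consists of two steps: the randomization [U n] takes [past n] to
    [hist n], and the observation [Y n] takes [hist n] to [past n.+1]. *)
Lemma past_randomization n :
  hist n `<=` <<s past n `|` generated_by (U n) >>.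
Proof.
apply: smallest_sub; first exact: smallest_sigma_algebra.
move=> A [] [i /=]; last first.
  move=> ic Ai; apply: sub_sigma_algebra; left.
  by apply: sub_sigma_algebra; right; exists i.
rewrite ltnS leq_eqVlt => /orP[/eqP -> Ai|ib Ai]; apply: sub_sigma_algebra.
  by right.
by left; apply: sub_sigma_algebra; left; exists i.
Qed.

Lemma history_observation n :
  past n.+1 `<=` <<s hist n `|` generated_by (Y n) >>.
Proof.
apply: smallest_sub; first exact: smallest_sigma_algebra.
move=> A [] [i /=].
  move=> ic Ai; apply: sub_sigma_algebra; left.
  by apply: sub_sigma_algebra; left; exists i.
rewrite ltnS leq_eqVlt => /orP[/eqP -> Ai|ib Ai]; apply: sub_sigma_algebra.
  by right.
by left; apply: sub_sigma_algebra; right; exists i.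
Qed.

Let sampled n : hist n [set w | a n w].
Proof.
have := @p_sampling _ _ _ T n j; congr (hist n _).
by apply/seteqP; split => w /= /eqP.
Qed.

Let M n w := expR (- (2 * theta) * masked_sum a Y n w).

(** The randomization has the same conditional law under all parameters, so it
    leaves the ratio unchanged: the case of [likelihood_step] in which the laws
    differ nowhere. *)
Lemma randomization_likelihood n :
  (forall E, past n E -> \int[P]_(w in E) (M n w)%:E = Q E)%E ->
  forall E, hist n E -> (\int[P]_(w in E) (M n w)%:E = Q E)%E.
Proof.
move=> IH E /past_randomization EG.
have MG : generated_by (M n) `<=` past n.
  apply: generated_expR_masked_sum; first exact: info_sigma_algebra.
    by move=> i ni; exact: info_obs.
  by move=> i ni; apply: (info_mono _ _ (@sampled i)) => //; exact: ltnW.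
have := likelihood_step (info_sigma_algebra n n) (@info_measurable n n)
  (@measurable_funPT _ _ _ _ (U n)) (@p_rand_law _ _ _ T s n)
  (@p_rand_law _ _ _ T flip_sign n)
  (fun w => expR_ge0 _) MG IH (a := fun=> false) (rho := cst 1)
  (lam := pK n point).
move=> /(_ _ _ _ _ _ _ E EG) <- //.
- by apply: eq_integral => w _; rewrite mulr1.
- have -> : [set w : pOmega T | false] = set0 by apply/seteqP; split.
  by case: (info_sigma_algebra n n).
Qed.

Lemma history_likelihood n E : hist n E ->
  (\int[P]_(w in E) (M n w)%:E = Q E)%E.
Proof.
elim: n E => [|n IH]; apply: randomization_likelihood => E.
  move=> E0; transitivity (P E).
    rewrite (eq_integral (cst 1%E)) ?integral_cst ?mul1e//.
      exact: info_measurable E0.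
    by move=> w _; rewrite /M /masked_sum big_ord0 mulr0 expR0.
  apply: (g_sigma_algebra_measure_unique [set setT] _ (fun=> setT)) => //.
  - by move=> _ ->.
  - by rewrite bigcup_const.
  - by move=> _ _ -> ->; rewrite setIT.
  - by move=> _ ->; rewrite [LHS]probability_setT [RHS]probability_setT.
  - by move=> _; rewrite ltey_eq fin_num_measure.
  - by apply: sub_sigma_algebra2 E0 => A [] [i].
move=> /history_observation; apply: (gaussian_likelihood_step
  (kP := fun w => gaussian (sgn R (s (pA T n w)) * Delta))
  (kQ := fun w => gaussian (sgn R (flip_sign (pA T n w)) * Delta))).
- exact: info_sigma_algebra.
- exact: info_measurable.
- exact: measurable_funPT.
- exact: p_obs_law.
- exact: p_obs_law.
- by move=> i ni; exact: info_obs.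
- by move=> i ni; apply: (info_mono _ _ (@sampled i)).
- by move=> w B /eqP ->.
- move=> w B /eqP -> _; rewrite ffunE eqxx /theta.
  by congr (gaussian _ B); case: (s j); rewrite /sgn /= ?mulN1r ?mul1r ?opprK.
- by move=> w B /negbTE naw _; rewrite ffunE [_ == j]naw.
- exact: IH.
Qed.

(** The event of a right decision on coordinate [j] under [s] is the event of an
    error on [j] under [flip_sign], so its [Q]-probability is at most [alpha]. *)
Lemma E_samples_ge :
  ((kl (1 - alpha) alpha / (2 * Delta ^+ 2))%:E <= E_samples T s j)%E.
Proof.
have th2 : theta ^+ 2 = Delta ^+ 2.
  by rewrite /theta /sgn; case: (s j); rewrite ?mul1r ?mulN1r ?sqrrN.
rewrite -th2 /E_samples /num_samples.
pose A := [set w | pdec T j (pS T w) = s j].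
have hA : stopped_history hist (ptau T) A.
  apply: p_output; exists (pdec T j @^-1` [set s j]); last by rewrite setTI.
  by rewrite -[X in measurable X]setTI; exact: p_decoder.
have [A1 A2] := hA.
have mA : measurable A.
  apply: (smallest_sub (@sigma_algebra_measurable _ (pOmega T)) _ A1).
  by move=> B [n _]; exact: info_measurable.
have err (s' : {ffun 'I_m -> bool}) :
    (pP T s' [set w | pdec T j (pS T w) <> s' j] <= alpha%:E)%E.
  by apply: le_trans (Tcorrect j); apply: ereal_sup_ubound; exists s'.
apply: (@expected_samples_bound _ _ _ P Q hist _ _ _ Y a theta _ _ _ _
  (ptau T) _ A alpha) => //.
- by move=> n; exact: info_sigma_algebra.
- by move=> n; exact: info_measurable.
- by move=> n; exact: info_mono.
- exact: history_likelihood.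
- move=> n E B EF Ea mB.
  rewrite (@p_obs_law _ _ _ T s n B mB).2// (eq_integral (cst (gaussian theta B))).
    by rewrite integral_cst 1?muleC//; exact: info_measurable EF.
  by move=> w /[!inE] /Ea /eqP ->.
- exact: p_stopping.
- have := err flip_sign; congr (_ <= _)%E; congr (Q _); apply/seteqP; rewrite /A.
  by split => w /=; rewrite ffunE eqxx; case: (s j); case: (pdec _ _ _).
- exact: err.
- by rewrite -sqrf_eq0 th2 sqrf_eq0 gt_eqF.
- exact: p_finite.
Qed.

End procedure_bound.

(** * Sequential tests *)

Section seq_test_bound.
Context (R : realType) (Delta alpha : R).
Hypotheses (hDelta : 0 < Delta) (halpha : 0 < alpha < 1 / 2).
Variable T : seq_test Delta.

Let U := tU T.
Let Z := @tZ _ _ T.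
Let hist n := one_history U Z n.

Lemma one_history_sigma_algebra n : sigma_algebra setT (hist n).
Proof. exact: smallest_sigma_algebra. Qed.

Lemma one_history_measurable n : hist n `<=` measurable.
Proof.
apply: smallest_sub; first exact: sigma_algebra_measurable.
by move=> A [|[i _]] /measurable_fun_generated_by; apply; exact: measurable_funPT.
Qed.

Lemma one_history_step n :
  hist n.+1 `<=` <<s hist n `|` generated_by (Z n) >>.
Proof.
apply: smallest_sub; first exact: smallest_sigma_algebra.
move=> A [AU|[i /=]].
  by apply: sub_sigma_algebra; left; apply: sub_sigma_algebra; left.
rewrite ltnS leq_eqVlt => /orP[/eqP -> Ai|ib Ai]; apply: sub_sigma_algebra.
  by right.
by left; apply: sub_sigma_algebra; right; exists i.
Qed.

Lemma one_history_mono n : hist n `<=` hist n.+1.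
Proof.
apply: sub_sigma_algebra2 => A [AU|[i /= ni Ai]]; [by left|right].
by exists i => //=; exact: ltnW.
Qed.

Lemma one_history_obs n i : (i < n)%N -> generated_by (Z i) `<=` hist n.
Proof. by move=> ni A Ai; apply: sub_sigma_algebra; right; exists i. Qed.

(** Independence says that [Z n] is independent of the boxes, that is of the
    events [U @^-1` B0 `&` \bigcap_(i in [set i | (i < n)%N]) Z i @^-1` C i].  The
    boxes are stable under intersection and generate the history. *)
Lemma one_history_cond_law s n :
  cond_law (tP T s) (hist n) (Z n) (fun=> gaussian (sgn R s * Delta)).
Proof.
move=> B mB; set c := gaussian _ B.
have [G0 GC _] := one_history_sigma_algebra n.
split.
  apply/generated_byP => C mC.
  have [Cc|nCc] := pselect (C c).
    by rewrite preimage_cst mem_set// -(setD0 setT); exact: GC.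
  by rewrite preimage_cst memNset.
move=> E EH.
have mZ i C : measurable C -> measurable (Z i @^-1` C).
  by move=> mC; rewrite -[_ @^-1` _]setTI; exact: measurable_funPT.
have mU C : measurable C -> measurable (U @^-1` C).
  by move=> mC; rewrite -[_ @^-1` _]setTI; exact: measurable_funPT.
rewrite integral_cst//; last exact: one_history_measurable EH.
have c0 : 0 <= fine c by apply: fine_ge0; exact: (measure_ge0 (gaussian _)).
have cE : (fine c)%:E = c by rewrite fineK//; exact: (fin_num_measure (gaussian _)).
rewrite -[LHS]/(mrestr (tP T s) (mZ n B mB) E).
have -> : (c * tP T s E = mscale (NngNum c0) (tP T s) E)%E.
  by rewrite /mscale /= cE.
pose box := [set D | exists2 B0, measurable B0 & exists2 C : nat -> set R,
  (forall i, measurable (C i)) &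
  D = U @^-1` B0 `&` \bigcap_(i in [set i | (i < n)%N]) (Z i @^-1` C i)].
have boxT : box setT.
  exists setT => //; exists (fun=> setT) => //.
  by apply/seteqP; split => w // _; split.
apply: (g_sigma_algebra_measure_unique box _ (fun=> setT)) => //.
- move=> _ [B0 mB0 [C mC ->]]; apply: measurableI; first exact: mU.
  by apply: bigcap_measurableType => i _; exact: mZ.
- by rewrite bigcup_const.
- move=> _ _ [B0 mB0 [C mC ->]] [B1 mB1 [C1 mC1 ->]].
  exists (B0 `&` B1); first exact: measurableI.
  exists (fun i => C i `&` C1 i); first by move=> i; exact: measurableI.
  rewrite setIACA -bigcapI preimage_setI; congr (_ `&` _).
- move=> _ [B0 mB0 [C mC ->]].
  pose C' i := if (i < n)%N then C i else B.
  have mC' i : measurable (C' i) by rewrite /C'; case: ifP.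
  have := t_indep s n.+1 mB0 mC'.
  have C'n : C' n = B by rewrite /C' ltnn.
  rewrite big_ord_recr /= C'n.
  rewrite (eq_bigr (fun i : 'I_n => tP T s (Z i @^-1` C i))); last first.
    by move=> i _; rewrite /C' ltn_ord.
  rewrite muleA -(t_indep s n mB0 mC).
  have -> : tP T s (tZ T n @^-1` B) = c by exact: t_obs_law.
  rewrite muleC /mrestr /mscale /= cE => <-.
  congr (tP T s _); rewrite -setIA; congr (_ `&` _).
  apply/seteqP; split => w /=.
    move=> [wC wB] i /=; rewrite ltnS leq_eqVlt => /orP[/eqP ->|ni].
      by rewrite /C' ltnn.
    by rewrite /C' ni; exact: wC.
  move=> wC; split; last by have := wC n (ltnSn n); rewrite /C' ltnn.
  by move=> i /= ni; have := wC i (ltnW ni); rewrite /C' ni.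
- by move=> _; rewrite ltey_eq fin_num_measure.
- apply: sub_sigma_algebra2 EH => D [[B0 mB0 <-]|[i /= ni [B0 mB0 <-]]].
    exists B0 => //; exists (fun=> setT) => //.
    by rewrite setTI; apply/seteqP; split => [w Bw|w []//]; split.
  exists setT => //; exists (fun k => if k == i then B0 else setT).
    by move=> k; case: ifP.
  rewrite preimage_setT; congr (_ `&` _); apply/seteqP; split => w /=.
    by move=> wB k /= kn; case: eqP => // ->.
  by move=> /(_ i ni) /=; rewrite eqxx.
Qed.

Variable s : bool.
Let theta : R := sgn R s * Delta.
Let P := tP T s.
Let Q := tP T (~~ s).

Lemma one_history_likelihood n E : hist n E ->
  (\int[P]_(w in E)
    (expR (- (2 * theta) * masked_sum (fun _ _ => true) Z n w))%:E = Q E)%E.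
Proof.
elim: n E => [|n IH] E.
  move=> E0; transitivity (P E).
    rewrite (eq_integral (cst 1%E)) ?integral_cst ?mul1e//.
      exact: one_history_measurable E0.
    by move=> w _; rewrite /masked_sum big_ord0 mulr0 expR0.
  have UT : generated_by U setT by exists setT => //; rewrite preimage_setT setTI.
  apply: (g_sigma_algebra_measure_unique (generated_by U) _ (fun=> setT)) => //.
  - by move=> A /measurable_fun_generated_by; apply; exact: measurable_funPT.
  - by rewrite bigcup_const.
  - move=> _ _ [B mB <-] [C mC <-]; exists (B `&` C); first exact: measurableI.
    by rewrite !setTI preimage_setI.
  - move=> _ [B mB <-]; rewrite setTI /P /Q.
    by have := @t_rand_law _ _ T B mB; case: s => // /esym.
  - by move=> _; rewrite ltey_eq fin_num_measure.
  - by apply: sub_sigma_algebra2 E0 => A [//|[i]].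
move=> /one_history_step; apply: (gaussian_likelihood_step
  (kP := fun=> gaussian (sgn R s * Delta))
  (kQ := fun=> gaussian (sgn R (~~ s) * Delta))).
- exact: one_history_sigma_algebra.
- exact: one_history_measurable.
- exact: measurable_funPT.
- exact: one_history_cond_law.
- exact: one_history_cond_law.
- by move=> i ni; exact: one_history_obs.
- move=> i ni; have -> : [set w : tOmega T | true] = setT by apply/seteqP; split.
  have [G0 GC _] := one_history_sigma_algebra n.
  by rewrite -(setD0 setT); exact: GC.
- by move=> w B _ _.
- move=> w B _ _; rewrite /theta.
  by congr (gaussian _ B); case: s; rewrite /sgn /= ?mulN1r ?mul1r ?opprK.
- by move=> w B /negP[].
- exact: IH.
Qed.

Lemma E_nu_ge : alpha_correct alpha T ->
  ((kl (1 - alpha) alpha / (2 * Delta ^+ 2))%:E <= E_nu T s)%E.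
Proof.
move=> [corT corF].
have th2 : theta ^+ 2 = Delta ^+ 2.
  by rewrite /theta /sgn; case: s; rewrite ?mul1r ?mulN1r ?sqrrN.
have E_nuE : E_nu T s = (\int[P]_w (\sum_(0 <= n <oo | ~~ stopped_by (tnu T w) n)
    (true%:R)%:E))%E.
  by apply: eq_integral => w _; rewrite -series_time.
have [->|nuy] := eqVneq (E_nu T s) +oo%E; first exact: leey.
have mS n : measurable [set w | ~~ stopped_by (tnu T w) n].
  have -> : [set w | ~~ stopped_by (tnu T w) n] =
      ~` [set w | stopped_by (tnu T w) n].
    by apply/seteqP; split => w /= /negP.
  by apply: measurableC; apply: (@one_history_measurable n); exact: t_stopping.
have fin : {ae P, forall w, tnu T w <> None}.
  have mf : measurable_fun setT (fun w => time_val R (tnu T w)).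
    rewrite (_ : (fun w => _) = (fun w => \sum_(0 <= n <oo)
        (\1_[set w | ~~ stopped_by (tnu T w) n] w)%:E)%E); last first.
      apply/funext => w; rewrite -series_time eseries_mkcond.
      apply: eq_eseriesr => n _; rewrite indicE mem_setE /in_mem /=.
      by case: ifP.
    apply: ge0_emeasurable_sum => n; first by move=> w _ _; rewrite lee_fin.
    by move=> _; apply/measurable_EFinP; exact: measurable_indic.
  have intf : P.-integrable setT (fun w => time_val R (tnu T w)).
    apply/integrableP; split => //.
    rewrite (eq_integral (fun w => time_val R (tnu T w))); last first.
      by move=> w _; rewrite gee0_abs//; case: (tnu T w) => //= k; rewrite lee_fin.
    by rewrite ltey.
  have := integrable_ae measurableT intf.
  by apply: filterS => w /(_ Logic.I) + tw; rewrite tw.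
rewrite E_nuE -th2.
pose A := [set w | tdec T w = s].
have hA : stopped_history hist (tnu T) A by exact: t_decision.
have mA : measurable A.
  apply: (smallest_sub (@sigma_algebra_measurable _ (tOmega T)) _ hA.1).
  by move=> B [n _]; exact: one_history_measurable.
apply: (@expected_samples_bound _ _ _ P Q hist _ _ _ Z (fun _ _ => true) theta
  _ _ _ _ (tnu T) _ A alpha) => //.
- exact: one_history_sigma_algebra.
- exact: one_history_measurable.
- exact: one_history_mono.
- move=> n; have -> : [set w : tOmega T | true] = setT by apply/seteqP; split.
  have [G0 GC _] := one_history_sigma_algebra n.
  by rewrite -(setD0 setT); exact: GC.
- exact: one_history_likelihood.
- move=> n E B EF _ mB; rewrite (one_history_cond_law s n mB).2//.
  by rewrite integral_cst 1?muleC//; exact: one_history_measurable EF.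
- exact: t_stopping.
- exact: hA.2.
- by rewrite /A /Q; case: s.
- have -> : ~` A = [set w | tdec T w = ~~ s].
    by rewrite /A; apply/seteqP; split => w /=; case: s; case: (tdec T w).
  by rewrite /P; case: s.
- by rewrite -sqrf_eq0 th2 sqrf_eq0 gt_eqF.
Qed.

End seq_test_bound.

(** * Total sample size *)

Section totals.
Context (R : realType) (m : nat) (Delta : R) (T : procedure m Delta).

Lemma num_samples_series (w : pOmega T) (j : 'I_m) :
  num_samples T j w = (\sum_(0 <= n <oo)
    (\1_[set w' | (pA T n w' == j) && ~~ stopped_by (ptau T w') n] w)%:E)%E.
Proof.
rewrite /num_samples eseries_mkcond; apply: eq_eseriesr => n _.
rewrite indicE mem_setE /in_mem /=.
by case: (stopped_by _ _) => /=; rewrite ?andbT ?andbF.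
Qed.

Lemma measurable_num_samples j : measurable_fun setT (num_samples T j).
Proof.
rewrite (funext (num_samples_series^~ j)).
apply: ge0_emeasurable_sum => n; first by move=> w _ _; rewrite lee_fin.
move=> _; apply/measurable_EFinP; apply: measurable_indic.
have -> : [set w' | (pA T n w' == j) && ~~ stopped_by (ptau T w') n] =
    [set w | pA T n w = j] `&` ~` [set w | stopped_by (ptau T w) n].
  apply/seteqP; split => w /=; first by move=> /andP[/eqP ? /negP].
  by move=> [/eqP ? /negP ?]; apply/andP.
apply: measurableI.
  by apply: (@info_measurable _ _ _ T n.+1 n); exact: p_sampling.
by apply: measurableC; apply: (@info_measurable _ _ _ T n.+1 n); exact: p_stopping.
Qed.

(** Exactly one coordinate is sampled at each time before [ptau]. *)
Lemma sum_num_samples (w : pOmega T) :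
  (\sum_(j < m) num_samples T j w = time_val R (ptau T w))%E.
Proof.
rewrite -series_time; under eq_bigr do rewrite /num_samples eseries_mkcond.
rewrite -nneseries_sum; last by move=> j n _; case: ifP.
rewrite [RHS]eseries_mkcond; apply: eq_eseriesr => n _.
case: (stopped_by _ _) => /=; first by rewrite big1.
rewrite (bigD1 (pA T n w))//= eqxx big1 ?adde0// => j jA.
by rewrite eq_sym (negbTE jA).
Qed.

Lemma E_tau_sum s : (E_tau T s = \sum_(j < m) E_samples T s j)%E.
Proof.
rewrite /E_samples -ge0_integral_sum//.
- by apply: eq_integral => w _; rewrite sum_num_samples.
- by move=> j; exact: measurable_num_samples.
- by move=> j w _; apply: nneseries_ge0 => n _ _; rewrite lee_fin.
Qed.

End totals.

Theorem corollary4 (R : realType) (Delta alpha : R) (m : nat)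
    (hDelta : 0 < Delta) (halpha : 0 < alpha < 1 / 2) (hm : (1 <= m)%N) :
  (forall T : seq_test Delta, alpha_correct alpha T ->
     ((kl (1 - alpha) alpha / (2 * Delta ^+ 2))%:E <= E_nu T true)%E /\
     ((kl (1 - alpha) alpha / (2 * Delta ^+ 2))%:E <= E_nu T false)%E) /\
  ((m%:R * kl (1 - alpha) alpha / (2 * Delta ^+ 2))%:E
     <= C_post m alpha Delta)%E /\
  (forall T : procedure m Delta, correct alpha T ->
     forall s : {ffun 'I_m -> bool},
       (forall j : 'I_m,
          ((kl (1 - alpha) alpha / (2 * Delta ^+ 2))%:E
             <= E_samples T s j)%E) /\
       ((m%:R * kl (1 - alpha) alpha / (2 * Delta ^+ 2))%:E
          <= E_tau T s)%E).
Proof.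
have total (T : procedure m Delta) s : correct alpha T ->
    ((m%:R * kl (1 - alpha) alpha / (2 * Delta ^+ 2))%:E <= E_tau T s)%E.
  move=> cT; rewrite E_tau_sum -mulrA -[m in m%:R]card_ord mulr_natl.
  rewrite -sumr_const -sumEFin; apply: lee_sum => j _.
  exact: E_samples_ge.
split; [|split].
- by move=> T cT; split; exact: E_nu_ge.
- apply: le_ereal_inf_tmp => _ [T cT ->].
  set c := (_ / _).
  have card2 : #|{ffun 'I_m -> bool}| = (2 ^ m)%N.
    by rewrite card_ffun card_bool card_ord.
  have -> : c%:E = ((2 ^- m)%:E * \sum_(s : {ffun 'I_m -> bool}) c%:E)%E.
    by rewrite sumEFin sumr_const card2 -EFinM -[c *+ _]mulr_natl natrX mulKf//.
  apply: lee_wpmul2l; first by rewrite lee_fin invr_ge0 exprn_ge0.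
  by apply: lee_sum => s _; exact: total.
- by move=> T cT s; split => [j|]; [exact: E_samples_ge|exact: total].
Qed.
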